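(* Let $X\subseteq\mathbb{R}^n$ be either a bounded cube or the entire space $\mathbb{R}^n$, and let $1<p<\infty$. Suppose that $f\in JN_p(X)$. Then $$\lim_{a\to 0}\ \sup_{\substack{Q\subseteq X\\ l(Q)\le a}} |Q|^{1/p}\,\frac{1}{|Q|}\int_Q |f| = 0,$$ where the supremum is taken over all cubes $Q\subseteq X$ such that the side length $l(Q)$ of $Q$ is at most $a$.
   Context: A cube means an open (bounded) cube in $\mathbb{R}^n$ with edges parallel to the coordinate axes; $l(Q)$ is its side length and $|Q|$ its Lebesgue measure. Write $f_Q=\frac{1}{|Q|}\int_Q f$. For $1<p<\infty$, a function $f$ is in $JN_p(X)$ if $f\in L^1_{loc}(X)$ and there is a constant $K<\infty$ such that $$\sum_{i=1}^\infty |Q_i|\left(\frac{1}{|Q_i|}\int_{Q_i}|f-f_{Q_i}|\right)^{p}\le K^p$$ for all countable collections of pairwise disjoint cubes $(Q_i)_{i=1}^\infty$ in $X$. *)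

(* Defs.v *)
From HB Require Import structures.
From mathcomp Require Import all_boot all_order all_algebra.
From mathcomp Require Import all_classical all_reals all_analysis.

Set Implicit Arguments.
Unset Strict Implicit.
Unset Printing Implicit Defensive.

Import Order.TTheory GRing.Theory Num.Theory.
Import numFieldNormedType.Exports.

Local Open Scope classical_set_scope.
Local Open Scope ring_scope.

(* A copy of ['rV[R]_n] carrying the Borel sigma-algebra, given as the product
   sigma-algebra generated by the coordinate projections. *)
Definition borel_rV (R : realType) (n : nat) : Type := 'rV[R]_n.

HB.instance Definition _ R n := Choice.on (borel_rV R n).
HB.instance Definition _ R n := isPointed.Build (borel_rV R n) (0 : 'rV[R]_n).

Section borel_rV.
Context (R : realType) (n : nat).

Definition rV_coord (i : 'I_n) (x : borel_rV R n) : measurableTypeR R :=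
  (x : 'rV[R]_n) ord0 i.

Let rV_set0 : g_sigma_preimage rV_coord set0.
Proof. exact: sigma_algebra0. Qed.

Let rV_setC A : g_sigma_preimage rV_coord A -> g_sigma_preimage rV_coord (~` A).
Proof. exact: sigma_algebraC. Qed.

Let rV_bigcup (F : _^nat) : (forall i, g_sigma_preimage rV_coord (F i)) ->
  g_sigma_preimage rV_coord (\bigcup_i F i).
Proof. exact: sigma_algebra_bigcup. Qed.

HB.instance Definition _ := @isMeasurable.Build default_measure_display
  (borel_rV R n) (g_sigma_preimage rV_coord) rV_set0 rV_setC rV_bigcup.

Lemma measurable_rV_coord i : measurable_fun setT (rV_coord i).
Proof.
move=> _ Y mY; rewrite setTI; apply: sub_sigma_algebra => /=.
rewrite -bigcup_seq/=; exists i => /=; first by rewrite mem_index_enum.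
by exists Y => //; rewrite setTI.
Qed.

Lemma measurable_fun_rV d (T : measurableType d) (f : T -> borel_rV R n) :
  (forall i, measurable_fun setT (rV_coord i \o f)) -> measurable_fun setT f.
Proof.
move=> mf.
suff sub : g_sigma_preimage (fun i => rV_coord i \o f) `<=` measurable.
  by move=> _ A mA; apply: sub; rewrite g_sigma_preimage_comp; exists A.
apply: smallest_sub; first exact: sigma_algebra_measurable.
rewrite -bigcup_seq/=; apply: bigcup_sub => i _.
by move=> A [B mB <-]; exact: mf.
Qed.

End borel_rV.

Section product_lebesgue.
Context (R : realType).

Definition cons_rV n (p : borel_rV R n * measurableTypeR R) :
    borel_rV R n.+1 :=
  \row_(i < n.+1) oapp (fun j => rV_coord j p.1) p.2 (unlift ord0 i).

Lemma measurable_cons_rV n : measurable_fun setT (@cons_rV n).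
Proof.
apply: measurable_fun_rV => i.
case: (unliftP ord0 i) => [j ->|->].
- rewrite (_ : _ \o _ = rV_coord j \o fst); last first.
    by apply/funext => p /=; rewrite /rV_coord /cons_rV mxE liftK.
  by apply: measurableT_comp => //; exact: measurable_rV_coord.
- rewrite (_ : _ \o _ = snd)//.
  by apply/funext => p /=; rewrite /rV_coord /cons_rV mxE unlift_none.
Qed.

Section step.
Context n (mu : {measure set (borel_rV R n) -> \bar R}).

Definition product_lebesgue_step : set (borel_rV R n.+1) -> \bar R :=
  pushforward (mu \x lebesgue_measure)%E (@cons_rV n).

Let step0 : product_lebesgue_step set0 = 0%E.
Proof. by rewrite /product_lebesgue_step /pushforward preimage_set0 measure0. Qed.

Let step_ge0 A : (0 <= product_lebesgue_step A)%E.
Proof. by rewrite /product_lebesgue_step /pushforward measure_ge0. Qed.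

Let step_sigma_additive : semi_sigma_additive product_lebesgue_step.
Proof.
apply: measure_semi_sigma_additive; exact: measurable_cons_rV.
Qed.

HB.instance Definition _ := isMeasure.Build _ _ _ product_lebesgue_step
  step0 step_ge0 step_sigma_additive.

End step.

Fixpoint product_lebesgue n : {measure set (borel_rV R n) -> \bar R} :=
  match n with
  | 0 => \d_(point : borel_rV R 0)
  | m.+1 => product_lebesgue_step (product_lebesgue m)
  end.

End product_lebesgue.

(* Lebesgue measure on R^n, defined on all Lebesgue-measurable sets: the
   completion of the n-fold product of the one-dimensional Lebesgue measure. *)
Definition lebesgue_rV (R : realType) (n : nat) : measurableType _ :=
  caratheodory_type (product_lebesgue R n)^*%mu.

Definition lebesgue_measure_rV (R : realType) (n : nat) :
    {measure set (lebesgue_rV R n) -> \bar R} :=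
  completed_measure_extension (mu := product_lebesgue R n).

Section cubes.
Context (R : realType) (n : nat).

Definition open_cube (c : 'rV[R]_n) (l : R) : set 'rV[R]_n :=
  [set x | forall i, c ord0 i < x ord0 i < c ord0 i + l].

(* [l] is the side length of [Q], which [Q] determines as soon as [0 < n]. *)
Definition is_cube (Q : set 'rV[R]_n) (l : R) : Prop :=
  0 < l /\ exists c, Q = open_cube c l.

End cubes.

Section open_cube_measure.
Context (R : realType).

Lemma product_lebesgue_box n (A : 'I_n -> set (measurableTypeR R)) :
  (forall i, measurable (A i)) ->
  product_lebesgue R n [set x | forall i, A i (rV_coord i x)] =
  (\prod_(i < n) lebesgue_measure (A i))%E.
Proof.
elim: n A => [|n IH] A mA.
  rewrite big_ord0 /= diracE mem_set//=.
  by case.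
rewrite big_ord_recl /= /product_lebesgue_step /pushforward.
rewrite (_ : _ @^-1` _ =
    [set x | forall j, A (lift ord0 j) (rV_coord j x)] `*` A ord0); last first.
  rewrite predeqE => -[x y]; rewrite /rV_coord /cons_rV/=; split => [h|[h h0] i].
    split => [j|]; last by have := h ord0; rewrite mxE unlift_none.
    by have := h (lift ord0 j); rewrite mxE liftK.
  by case: (unliftP ord0 i) => [j ->|->]; rewrite mxE ?liftK ?unlift_none//; exact: h.
rewrite product_measure1E//=; last first.
  rewrite (_ : mkset _ = \bigcap_(j in setT)
      (@rV_coord R n j @^-1` A (lift ord0 j))); last first.
    by rewrite predeqE => x; split => [h j _|h j]; [exact: h|exact: (h j I)].
  apply: fin_bigcap_measurable => // j _.
  by rewrite -[X in measurable X]setTI; exact: measurable_rV_coord.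
rewrite muleC; congr (_ * _)%E.
exact: (IH (fun j => A (lift ord0 j))).
Qed.

Lemma measurable_open_cube n (c : 'rV[R]_n) l :
  measurable (open_cube c l : set (borel_rV R n)).
Proof.
rewrite (_ : open_cube c l = \bigcap_(j in setT)
    (@rV_coord R n j @^-1` `]c ord0 j, c ord0 j + l[)); last first.
  rewrite predeqE => x; rewrite /open_cube /rV_coord/=.
  by split => [h j _|h j]; [rewrite /= in_itv/=|have /= := h j I; rewrite in_itv/=].
apply: fin_bigcap_measurable => // j _.
rewrite -[X in measurable X]setTI; apply: measurable_rV_coord => //.
Qed.

Lemma measurable_open_cube_rV n (c : 'rV[R]_n) l :
  measurable (open_cube c l : set (lebesgue_rV R n)).
Proof.
by apply: sub_caratheodory; apply: sub_sigma_algebra; exact: measurable_open_cube.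
Qed.

Lemma lebesgue_measure_open_cube n (c : 'rV[R]_n) l : 0 <= l ->
  lebesgue_measure_rV R n (open_cube c l) = (l ^+ n)%:E.
Proof.
move=> l0; pose A (i : 'I_n) : set (measurableTypeR R) :=
  `]c ord0 i, c ord0 i + l[%classic.
have cubeE : open_cube c l = [set x | forall i, A i (rV_coord i x)].
  rewrite predeqE => x; rewrite /open_cube /rV_coord/=.
  by split => h j; have := h j; rewrite /A /= in_itv/=.
transitivity (product_lebesgue R n (open_cube c l)).
  by apply: measurable_mu_extE; exact: measurable_open_cube.
rewrite cubeE; transitivity (\prod_(i < n) lebesgue_measure (A i))%E.
  by apply: product_lebesgue_box => i; exact: measurable_itv.
rewrite (eq_bigr (fun=> l%:E)) ?prodEFin ?prodr_const ?card_ord// => i _.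
rewrite lebesgue_measure_itv/= lte_fin ltrDl.
case: ifPn => [_|]; first by rewrite -EFinD addrAC subrr add0r.
by rewrite -leNgt => l0'; rewrite (@le_anti _ _ l 0) ?l0' ?l0.
Qed.

End open_cube_measure.

Section JN.
Context (R : realType) (n : nat).
Local Notation mu := (lebesgue_measure_rV R n).
Local Open Scope ereal_scope.

Definition mean (Q : set 'rV[R]_n) (g : 'rV[R]_n -> \bar R) : \bar R :=
  (mu Q)^-1 * \int[mu]_(x in Q) g x.

Definition L1loc (X : set 'rV[R]_n) (f : 'rV[R]_n -> R) : Prop :=
  measurable_fun (X : set (lebesgue_rV R n)) (f : lebesgue_rV R n -> R) /\
  forall K : set 'rV[R]_n, K `<=` X -> compact K ->
    \int[mu]_(x in K) `|f x|%:E < +oo.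

(* If [f] is not integrable on [Q] then [mean Q (EFin \o f)] may be infinite or
   meaningless and its [fine] part is just some real number; the oscillation
   is then [+oo], hence bounding it forces integrability on [Q]. *)
Definition oscillation (f : 'rV[R]_n -> R) (Q : set 'rV[R]_n) : \bar R :=
  mean Q (fun x => `|f x - fine (mean Q (EFin \o f))|%:E).

(* The index set [I] allows for finite as well as infinite collections. *)
Definition JN (p : R) (X : set 'rV[R]_n) (f : 'rV[R]_n -> R) : Prop :=
  L1loc X f /\
  exists2 K : R, (0 <= K)%R &
    forall (I : set nat) (Q : nat -> set 'rV[R]_n),
      (forall i, I i -> Q i `<=` X /\ exists l, is_cube (Q i) l) ->
      trivIset I Q ->
      \esum_(i in I) (mu (Q i) * (oscillation f (Q i)) `^ p) <= (K `^ p)%:E.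

End JN.

(* Main.v *)
Require Import Defs.
From mathcomp Require Import all_boot all_order all_algebra.
From mathcomp Require Import all_classical all_reals all_analysis.
From mathcomp Require Import measurable_realfun ring lra.
Import Order.TTheory GRing.Theory Num.Theory.
Import numFieldNormedType.Exports.
Local Open Scope classical_set_scope.
Local Open Scope ring_scope.

Set Implicit Arguments.
Unset Strict Implicit.
Unset Printing Implicit Defensive.


(** Put theta = n / p, let A(Q) be the average of |f| over a cube Q of side l
    and w(Q) the mean oscillation of f on Q.  Since |Q|^(1/p) = l^theta, the
    JN condition bounds the sum of (l^theta w(Q))^p over disjoint cubes, and
    the theorem says that l^theta A(Q) tends to 0 with l, uniformly in Q.

    Enlarging a cube Q to a cube Q' changes the average of |f| by at most a
    multiple of w(Q'), the factor depending only on the ratio of the sides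
    ([cube_avg_le_outer], [cube_avg_le_inner]).  As w(Q') <= K l'^-theta, these
    errors form a geometric series along a chain of doublings, whence a bound
    l^theta A(Q) <= B for all cubes with l <= 1 ([cube_avg_bounded]).

    The bound forces oscillation.  Suppose that l^theta A(Q) >= e and enlarge Q
    by a factor lam with lam^theta much larger than B / e.  If the average
    hardly changed, then lam^theta l^theta A(Q) would exceed B on the larger
    cube.  So the larger cube has scaled oscillation at least some delta > 0
    that depends on e only ([oscillation_of_outgrown_average]).

    If the theorem failed, there would thus be arbitrarily small cubes whose
    scaled oscillation is at least delta, and infinitely many disjoint ones
    among them would contradict the JN condition.  To make them disjoint, use
    compactness: the small cubes with l^theta A(Q) >= e accumulate at a point x
    or escape to infinity.  In the second case a sparse subsequence is
    disjoint.  In the first case all the cubes may contain x.  But a cube of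
    side eta l placed around x carries only a proportion eta^(n - theta) B / e
    of the mass of |f| on Q, which is small because theta < n, i.e. p > 1.  So
    some subcube of Q of comparable size that stays away from x still has a
    large scaled average ([subcube_avoiding_point]), and it can be enlarged in
    the directions leading away from x ([cube_between_avoiding]).  The resulting
    oscillating cube is at a positive distance from x, the next one is chosen
    closer to x than that, and so on ([no_escaping_oscillating_cubes]). *)
(** * Elementary bounds and the geometry of cubes *)

Section real_powers.
Context {R : realType}.

Lemma powR_le_base (a b r : R) : 0 <= r -> 0 <= a -> a <= b ->
  a `^ r <= b `^ r.
Proof.
move=> r0 a0 ab; apply: ge0_ler_powR => //; rewrite nnegrE//.
exact: le_trans ab.
Qed.

Lemma exists_large_powR (a t : R) : 0 < t ->
  exists2 r : R, 1 <= r & a <= r `^ t.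
Proof.
move=> t0; exists (Num.max 1 (Num.max 0 a `^ t^-1)).
  by rewrite le_max lexx.
apply: (@le_trans _ _ ((Num.max 0 a `^ t^-1) `^ t)).
  by rewrite -powRrM mulVf ?gt_eqF// powRr1 ?le_max ?lexx ?orbT.
by apply: powR_le_base; rewrite ?powR_ge0 ?le_max ?lexx ?orbT// ltW.
Qed.

Lemma exists_small_powR (a t : R) : 0 < a -> 0 < t ->
  exists r : R, [/\ 0 < r, r <= 1 & r `^ t <= a].
Proof.
move=> a0 t0; have [r r1 ar] := exists_large_powR a^-1 t0.
have r0 : 0 < r by exact: lt_le_trans r1.
exists r^-1; split; [by rewrite invr_gt0|by rewrite invf_le1|].
have -> : r^-1 `^ t = (r `^ t)^-1.
  by rewrite -powR_inv1 ?ltW// -powRrM mulN1r powRN.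
by rewrite -[leRHS]invrK lef_pV2// posrE ?invr_gt0// powR_gt0.
Qed.

Lemma truncn_inv_lt (g : R) : 0 < g -> (Num.truncn g^-1).+1%:R^-1 < g.
Proof.
by move=> g0; rewrite invf_plt ?posrE// truncnS_gt.
Qed.

End real_powers.

Section cube_geometry.
Context {R : realType} {n : nat}.
Implicit Types (c x y : 'rV[R]_n) (l s L : R).

(** The inclusion is tested along the diagonal from the corner [c], which meets
    every pair of opposite faces. *)
Lemma open_cube_subsetP c l c' l' : 0 < l ->
  (open_cube c l `<=` open_cube c' l') <->
  (forall i, c' ord0 i <= c ord0 i /\ c ord0 i + l <= c' ord0 i + l').
Proof.
move=> l0; split=> [sub i|h y yc i]; last first.
  by have := yc i; have := h i; lra.
have diag t : 0 < t < l -> c' ord0 i < c ord0 i + t < c' ord0 i + l'.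
  move=> tl; have /sub/(_ i) : open_cube c l (\row_j (c ord0 j + t)).
    by move=> j; rewrite mxE; lra.
  by rewrite mxE.
split; rewrite leNgt; apply/negP => lt.
- have := diag (Num.min (c' ord0 i - c ord0 i) (l / 2)).
  by rewrite /Num.min; case: ifPn => ? ; lra.
- have := diag (Num.max (c' ord0 i + l' - c ord0 i) (l / 2)).
  by rewrite /Num.max; case: ifPn => ? ; lra.
Qed.

Lemma open_cube_subset_le c l c' l' : (0 < n)%N -> 0 < l ->
  open_cube c l `<=` open_cube c' l' -> l <= l'.
Proof.
move=> n0 l0 /(open_cube_subsetP _ _ _ l0)/(_ (Ordinal n0)); lra.
Qed.

Lemma interval_between {a0 L a l s : R} : a0 <= a -> a + l <= a0 + L ->
  l <= s <= L -> exists t, [/\ a0 <= t <= a & a + l <= t + s <= a0 + L].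
Proof.
by move=> ? ? ?; exists (Num.min a (a0 + L - s)); split;
  rewrite /Num.min; case: ifPn => ?; lra.
Qed.

(** The interval grows away from [x].  If it lies to the right of [x], it keeps
    its left end, and there is room on the right as long as everything happens
    within half the distance from [x] to the right end of the container; when
    [x] is at or beyond that end there is no such interval.  This is why [rho]
    depends on the position of [x], and why it stays positive when [x] is an
    endpoint of the container. *)
Lemma interval_between_avoiding (a0 L x : R) : exists2 rho, 0 < rho &
  forall a l s, 0 < l -> l <= s -> s <= rho -> s <= L ->
    a0 <= a -> a + l <= a0 + L -> `|a - x| <= rho ->
    exists t, [/\ a0 <= t <= a, a + l <= t + s <= a0 + L,
      x < a -> x < t & a + l < x -> t + s < x].
Proof.
pose d1 := if x < a0 + L then (a0 + L - x) / 2 else 1.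
pose d2 := if a0 < x then (x - a0) / 2 else 1.
exists (Num.min d1 d2).
  by rewrite lt_min; apply/andP; split; rewrite /d1 /d2; case: ifPn => ?; lra.
move=> a l s l0 ls; rewrite !le_min => /andP[s1 s2] sL aa aL /andP[x1 x2].
have {}x1 : a - x <= d1 by apply: le_trans x1; exact: ler_norm.
have {}x2 : x - a <= d2 by apply: le_trans x2; rewrite distrC; exact: ler_norm.
have [xa|xa] := ltP x a.
  exists a; split; try lra.
  by move: s1 x1; rewrite /d1; case: ifPn => ?; lra.
have [ax|ax] := ltP (a + l) x.
  exists (a + l - s); split; try lra.
  by move: s2 x2; rewrite /d2; case: ifPn => ?; lra.
have lsL : l <= s <= L by rewrite ls.
have [t [ta tl]] := interval_between aa aL lsL.
by exists t; split; lra.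
Qed.

Lemma cube_between {c0 L c l s} : 0 < l -> l <= s <= L ->
  open_cube c l `<=` open_cube c0 L ->
  exists c1, open_cube c l `<=` open_cube c1 s /\
             open_cube c1 s `<=` open_cube c0 L.
Proof.
move=> l0 lsL /(open_cube_subsetP _ _ _ l0) sub.
have /choice[t ht] i := interval_between (sub i).1 (sub i).2 lsL.
exists (\row_i t i); split; apply/open_cube_subsetP; try lra.
  by move=> i; rewrite mxE; have [] := ht i; lra.
by move=> i; rewrite mxE; have [] := ht i; lra.
Qed.

(** All coordinates are handled at once: any coordinate in which the cube is
    strictly on one side of [x] keeps this property, so that a cube whose
    closure misses [x] is enlarged to a cube whose closure misses [x]. *)
Lemma cube_between_avoiding c0 L x : exists2 rho, 0 < rho &
  forall c l s, 0 < l -> l <= s -> s <= rho -> s <= L ->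
    open_cube c l `<=` open_cube c0 L ->
    (forall i, `|c ord0 i - x ord0 i| <= rho) ->
    exists c1, [/\ open_cube c l `<=` open_cube c1 s,
      open_cube c1 s `<=` open_cube c0 L &
      forall i, (x ord0 i < c ord0 i -> x ord0 i < c1 ord0 i) /\
                (c ord0 i + l < x ord0 i -> c1 ord0 i + s < x ord0 i)].
Proof.
pose hrho i := cid2 (interval_between_avoiding (c0 ord0 i) L (x ord0 i)).
pose r i := s2val (hrho i).
have r0 i : 0 < r i := s2valP (hrho i).
have hr i := s2valP' (hrho i).
exists (\big[Num.min/1]_i r i).
  by apply: lt_bigmin => // i _; exact: r0.
move=> c l s l0 ls srho sL /(open_cube_subsetP _ _ _ l0) sub xc.
have rle i : \big[Num.min/1]_j r j <= r i by exact: bigmin_le_cond.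
have /choice[t ht] i := hr i _ _ _ l0 ls (le_trans srho (rle i)) sL
  (sub i).1 (sub i).2 (le_trans (xc i) (rle i)).
exists (\row_i t i); split; first 2 last.
- by move=> i; rewrite mxE; have [_ _ ] := ht i.
- by apply/open_cube_subsetP => // i; rewrite mxE; have [] := ht i; lra.
- apply/open_cube_subsetP; first lra.
  by move=> i; rewrite mxE; have [] := ht i; lra.
Qed.

(** Consecutive cubes of the grid overlap by half, so that the open cubes cover
    an open cube entirely, and not only up to the null set of the walls. *)
Definition grid_corner M c h (v : {ffun 'I_n -> 'I_M}) : 'rV[R]_n :=
  \row_i (c ord0 i + h * (v i)%:R).

Lemma overlapping_unit_intervals M (t : R) : 0 < t < M.+2%:R ->
  exists v : 'I_M.+1, v%:R < t < v%:R + 2.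
Proof.
elim: M => [|M IH] tM; first by exists ord0 => /=; rewrite add0r.
have [tM2|tM2] := ltP t M.+2%:R; last first.
  exists ord_max => /=; rewrite -[_.+2]/(2 + M.+1)%N natrD in tM.
  by move: tM2; rewrite -[M.+2]/(1 + M.+1)%N natrD; lra.
have [|v hv] := IH; first by rewrite tM2 andbT; case/andP: tM.
by exists (widen_ord (leqnSn _) v).
Qed.

Lemma grid_cover M c l y : open_cube c l y ->
  exists v : {ffun 'I_n -> 'I_M.+1},
    open_cube (grid_corner c (l / M.+2%:R) v) (2 * (l / M.+2%:R)) y.
Proof.
move=> yc; set h := l / _.
have /choice[v hv] (i : 'I_n) : exists v : 'I_M.+1,
    h * v%:R < y ord0 i - c ord0 i < h * (v%:R + 2).
  have yci := yc i; have l0 : 0 < l by lra.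
  have h0 : 0 < h by rewrite divr_gt0.
  have [|v hv] := @overlapping_unit_intervals M ((y ord0 i - c ord0 i) / h).
    by rewrite ltr_pdivlMr// ltr_pdivrMr// mul0r [_ * h]mulrC divfK//; lra.
  exists v; move: hv; rewrite ltr_pdivlMr// ltr_pdivrMr// => hv.
  by rewrite ![h * _]mulrC.
by exists [ffun i => v i] => i; rewrite mxE ffunE; have := hv i; lra.
Qed.

Lemma grid_subset M c l (v : {ffun 'I_n -> 'I_M.+1}) : 0 < l ->
  open_cube (grid_corner c (l / M.+2%:R) v) (2 * (l / M.+2%:R)) `<=`
  open_cube c l.
Proof.
move=> l0 y yc i; have := yc i; rewrite mxE; set h := l / _.
have h0 : 0 < h by rewrite divr_gt0.
have lE : l = h * M%:R + 2 * h.
  by rewrite [2 * h]mulrC -mulrDr -natrD addn2 /h divfK.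
have vM : (v i)%:R <= M%:R :> R by rewrite ler_nat -ltnS.
have v0 : 0 <= (v i)%:R :> R by [].
nra.
Qed.

(** The cube of side [s] centred at [x] need not lie in the given cube; sliding
    it inside loses no point of the intersection. *)
Lemma clipped_neighbourhood_subcube c l x (s : R) : 0 < s -> s <= l ->
  exists c0, open_cube c0 s `<=` open_cube c l /\
    forall y, open_cube c l y ->
      (forall i, `|y ord0 i - x ord0 i| < s / 2) -> open_cube c0 s y.
Proof.
move=> s0 sl.
have /choice[t ht] (i : 'I_n) : exists t : R,
    [/\ c ord0 i <= t, t + s <= c ord0 i + l & forall y : R,
      c ord0 i < y < c ord0 i + l -> x ord0 i - s / 2 < y < x ord0 i + s / 2 ->
      t < y < t + s].
  have [h1|h1] := ltP (x ord0 i - s / 2) (c ord0 i).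
    by exists (c ord0 i); split => [||y]; lra.
  have [h2|h2] := ltP (c ord0 i + l - s) (x ord0 i - s / 2).
    by exists (c ord0 i + l - s); split => [||y]; lra.
  by exists (x ord0 i - s / 2); split => [||y]; lra.
exists (\row_i t i); split=> [|y yc yx i].
  by apply/open_cube_subsetP => // i; rewrite mxE; have [] := ht i.
rewrite mxE; have [_ _] := ht i; apply; first exact: yc.
by have := yx i; rewrite ltr_norml; lra.
Qed.

Lemma setT_common_cube c l c' l' : 0 < l -> 0 < l' ->
  exists c1 l1, open_cube c l `<=` open_cube c1 l1 /\
                open_cube c' l' `<=` open_cube c1 l1.
Proof.
move=> l0 l0'.
pose m := \big[Num.max/1]_i (Num.max `|c ord0 i| `|c' ord0 i|).
have hm i : -m <= c ord0 i <= m /\ -m <= c' ord0 i <= m.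
  have : Num.max `|c ord0 i| `|c' ord0 i| <= m by exact: le_bigmax_cond.
  by rewrite ge_max !ler_norml => /andP[].
have m1 : 1 <= m by exact: bigmax_ge_id.
exists (\row_i (- m)), (2 * m + l + l'); split.
- by apply/open_cube_subsetP => // i; rewrite mxE; have := hm i; lra.
- by apply/open_cube_subsetP => // i; rewrite mxE; have := hm i; lra.
Qed.

End cube_geometry.

(** * Integrals of recentred functions *)

Section integral_lemmas.
Context {d} {T : measurableType d} {R : realType}.
Context (mu : {measure set T -> \bar R}).
Implicit Types (E A : set T) (f : T -> R) (m : R).

Lemma integrable_cst E m : measurable E -> (mu E < +oo)%E ->
  mu.-integrable E (EFin \o (fun=> m)).
Proof.
move=> mE Efin; apply/integrableP; split; first exact/measurable_EFinP.
rewrite (eq_integral (cst `|m|%:E))// integral_cst//.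
by rewrite lte_mul_pinfty.
Qed.

(** For [m] the mean of [f], this turns a finite oscillation into
    integrability. *)
Lemma integrable_of_recentered E f m : measurable E -> (mu E < +oo)%E ->
  measurable_fun E f -> (\int[mu]_(x in E) `|f x - m|%:E < +oo)%E ->
  mu.-integrable E (EFin \o f).
Proof.
move=> mE Efin mf fm.
have fmi : mu.-integrable E (EFin \o (fun x => f x - m)).
  apply/integrableP; split => //.
  by apply/measurable_EFinP; exact: measurable_funB.
apply: eq_integrable (integrableD mE fmi (integrable_cst m mE Efin)) => //.
by move=> x _; rewrite /= -EFinD subrK.
Qed.

Lemma integrable_recentered E f m : measurable E -> (mu E < +oo)%E ->
  mu.-integrable E (EFin \o f) ->
  mu.-integrable E (EFin \o (fun x => `|f x - m|)).
Proof.
move=> mE Efin fE.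
have fmi : mu.-integrable E (EFin \o (fun x => f x - m)).
  exact: eq_integrable (integrableB mE fE (integrable_cst m mE Efin)).
exact: (integrable_norm fmi).
Qed.

Lemma le_Rintegral_normr_recentered E f m : measurable E -> (mu E < +oo)%E ->
  mu.-integrable E (EFin \o f) ->
  \int[mu]_(x in E) `|f x| <=
    `|m| * fine (mu E) + \int[mu]_(x in E) `|f x - m|.
Proof.
move=> mE Efin fE.
have mi := integrable_cst `|m| mE Efin.
have fmi := integrable_recentered m mE Efin fE.
rewrite -Rintegral_cst// -RintegralD//.
apply: le_Rintegral => //; first exact: (integrable_norm fE).
  exact: eq_integrable (integrableD mE mi fmi).
by move=> x _; rewrite -[in leLHS](subrKC m (f x)) ler_normD.
Qed.

Lemma recentered_le_Rintegral_normr E f m : measurable E -> (mu E < +oo)%E ->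
  mu.-integrable E (EFin \o f) ->
  `|m| * fine (mu E) <=
    \int[mu]_(x in E) `|f x| + \int[mu]_(x in E) `|f x - m|.
Proof.
move=> mE Efin fE.
have fi := integrable_norm fE.
have fmi := integrable_recentered m mE Efin fE.
rewrite -Rintegral_cst// -RintegralD//.
apply: le_Rintegral => //; first exact: integrable_cst.
  exact: eq_integrable (integrableD mE fi fmi).
by move=> x _; rewrite distrC -[in leLHS](subrKC (f x) m) ler_normD.
Qed.

Lemma Rintegral_subset E A f : measurable E -> measurable A -> A `<=` E ->
  mu.-integrable E (EFin \o f) -> (forall x, 0 <= f x) ->
  \int[mu]_(x in A) f x <= \int[mu]_(x in E) f x.
Proof.
move=> mE mA AE fE f0; rewrite -lee_fin.
have fA := integrableS mE mA AE fE.
rewrite /Rintegral !fineK ?integrable_fin_num//.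
apply: ge0_subset_integral => //; first by case/integrableP: fE.
by move=> x _; rewrite lee_fin.
Qed.

(** The set [A] is kept apart from the family since it will be a small cube
    whose contribution is estimated separately. *)
Lemma Rintegral_cover (I : finType) (P : pred I) (F : I -> set T) E A f :
  measurable E -> measurable A -> (forall i, measurable (F i)) ->
  A `<=` E -> (forall i, F i `<=` E) ->
  E `<=` A `|` \bigcup_(i in [set i | P i]) F i ->
  mu.-integrable E (EFin \o f) -> (forall x, 0 <= f x) ->
  \int[mu]_(x in E) f x <=
    \int[mu]_(x in A) f x + \sum_(i | P i) \int[mu]_(x in F i) f x.
Proof.
move=> mE mA mF AE FE cov fE f0.
have fin B : measurable B -> B `<=` E ->
    (\int[mu]_(x in B) f x)%:E = (\int[mu]_(x in E) ((EFin \o f) \_ B) x)%E.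
  move=> mB BE; rewrite /Rintegral fineK; last first.
    by apply: integrable_fin_num => //; exact: integrableS fE.
  by rewrite -integral_mkcondr (setIidr BE).
have mf : measurable_fun E (EFin \o f) by case/integrableP: fE.
have mr B : measurable B -> measurable_fun E ((EFin \o f) \_ B).
  move=> mB; apply/(measurable_restrict _ mB mE).
  by apply: measurable_funS mf => //; exact: subIsetl.
have r0 B x : (0 <= ((EFin \o f) \_ B) x)%E.
  by apply: erestrict_ge0 => y _; rewrite lee_fin.
rewrite -lee_fin EFinD -sumEFin (fin E)// (fin A)//.
under eq_bigr do rewrite fin//.
rewrite -big_filter -ge0_integral_sum//; last by move=> i; exact: mr.
rewrite -ge0_integralD//; last 3 first.
- exact: mr.
- by move=> x _; apply: sume_ge0.
- by apply: emeasurable_sum => i; exact: mr.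
apply: ge0_le_integral => //.
- exact: mr.
- apply: emeasurable_funD; first exact: mr.
  by apply: emeasurable_sum => i; exact: mr.
move=> x Ex; rewrite {1}patchE mem_set//=.
have [Ax|[i Pi Fx]] := cov x Ex.
  by rewrite patchE mem_set//= leeDl// sume_ge0.
rewrite big_filter (bigD1 i)//= [X in (_ + (X + _))%E]patchE mem_set//=.
rewrite -[leLHS]add0e leeD// leeDl// sume_ge0//.
Qed.

End integral_lemmas.

(** * Averages and oscillations of a JN function on cubes *)

Section JN_cubes.
Context {R : realType} {n : nat}.
Local Notation mu := (lebesgue_measure_rV R n).
Implicit Types (c : 'rV[R]_n) (l : R) (f : 'rV[R]_n -> R).

Definition cube_avg f c l : R :=
  (l ^+ n)^-1 * \int[mu]_(x in open_cube c l) `|f x|.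

(** The oscillation of a JN function is finite on cubes ([oscillation_fin]), so
    its real part loses nothing. *)
Definition cube_osc f c l : R := fine (oscillation f (open_cube c l)).

Lemma cube_measure_lty c l : 0 < l -> (mu (open_cube c l) < +oo)%E.
Proof. by move=> l0; rewrite lebesgue_measure_open_cube ?ltry// ltW. Qed.

Lemma fine_cube_measure c l : 0 < l -> fine (mu (open_cube c l)) = l ^+ n.
Proof. by move=> l0; rewrite lebesgue_measure_open_cube ?ltW. Qed.

Lemma mean_open_cube c l g : 0 < l -> mean (open_cube c l) g =
  (((l ^+ n)^-1)%:E * \int[mu]_(x in open_cube c l) g x)%E.
Proof.
move=> l0; rewrite /mean lebesgue_measure_open_cube ?ltW// inver.
by rewrite gt_eqF// exprn_gt0.
Qed.

Lemma oscillation_ge0 c l f : 0 < l -> (0 <= oscillation f (open_cube c l))%E.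
Proof.
move=> l0; rewrite /oscillation mean_open_cube// mule_ge0//.
  by rewrite lee_fin invr_ge0 exprn_ge0// ltW.
by apply: integral_ge0 => x _; rewrite lee_fin.
Qed.

Lemma cube_avg_ge0 f c l : 0 < l -> 0 <= cube_avg f c l.
Proof.
move=> l0; apply: mulr_ge0; first by rewrite invr_ge0 exprn_ge0// ltW.
by apply: Rintegral_ge0 => x _.
Qed.

(** The JN condition for finite families of cubes given by corner and side, with
    the constant made explicit; these families suffice for all that follows. *)
Definition cube_JN (K p : R) (X : set 'rV[R]_n) f : Prop :=
  [/\ 0 <= K, measurable_fun (X : set (lebesgue_rV R n)) f &
  forall N (c : nat -> 'rV[R]_n) (l : nat -> R),
    (forall i, (i < N)%N -> 0 < l i /\ open_cube (c i) (l i) `<=` X) ->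
    trivIset `I_N (fun i => open_cube (c i) (l i)) ->
    (\sum_(i < N) (l i ^+ n)%:E * oscillation f (open_cube (c i) (l i)) `^ p
       <= (K `^ p)%:E)%E].

Lemma JN_cube_JN p X f : JN p X f -> exists K, cube_JN K p X f.
Proof.
case=> -[mf _] [K K0 hK]; exists K; split => // N c l hl triv.
have := hK `I_N (fun i => open_cube (c i) (l i)).
move=> /(_ _ triv); rewrite esum_fset//; last first.
  move=> i _; apply: mule_ge0 => //; exact: poweR_ge0.
rewrite -fsbig_ord.
under eq_bigr => i _ do rewrite lebesgue_measure_open_cube ?(ltW (hl i _).1)//.
apply=> i /= /hl[l0 lX]; split => //.
by exists (l i); split => //; exists (c i).
Qed.

Context (X : set 'rV[R]_n) (K p : R) (f : 'rV[R]_n -> R).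
Context (mX : measurable (X : set (lebesgue_rV R n))).
Context (p1 : 1 < p).
Context (hf : cube_JN K p X f).

Let p0 : 0 < p. Proof. exact: lt_trans ltr01 p1. Qed.

(** The family reduced to one cube bounds its oscillation. *)
Lemma oscillation_fin c l : 0 < l -> open_cube c l `<=` X ->
  oscillation f (open_cube c l) = (cube_osc f c l)%:E.
Proof.
move=> l0 cX; rewrite /cube_osc fineK//.
have triv1 : trivIset `I_1 (fun=> open_cube c l) by move=> [|i] [|j].
have [K0 _ /(_ 1%N (fun=> c) (fun=> l))] := hf.
rewrite big_ord1 => hK.
have o0 := oscillation_ge0 c f l0.
rewrite ge0_fin_numE// ltNge; apply/negP; rewrite leye_eq => /eqP oy.
have := hK (fun _ _ => conj l0 cX) triv1.
by rewrite oy poweRyr ?gt_eqF// gt0_muley ?lte_fin ?exprn_gt0.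
Qed.

Lemma cube_osc_ge0 c l : 0 < l -> 0 <= cube_osc f c l.
Proof. by move=> l0; apply: fine_ge0; exact: oscillation_ge0. Qed.

(** Were the integral of |f - m| infinite, with [m] the real part of the mean,
    the oscillation would be infinite too. *)
Lemma cube_integrable c l : 0 < l -> open_cube c l `<=` X ->
  mu.-integrable (open_cube c l) (EFin \o f).
Proof.
move=> l0 cX; have mc := measurable_open_cube_rV c l.
have [_ mf _] := hf.
have mfc : measurable_fun (open_cube c l : set (lebesgue_rV R n)) f.
  exact: measurable_funS mf.
apply: (@integrable_of_recentered _ _ _ mu _ _
  (fine (mean (open_cube c l) (EFin \o f)))) => //.
  exact: cube_measure_lty.
rewrite ltey; apply/eqP => oy.
have := oscillation_fin l0 cX; rewrite /oscillation mean_open_cube// oy.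
by rewrite gt0_muley// lte_fin invr_gt0 exprn_gt0.
Qed.

Let center c l : R := fine (mean (open_cube c l) (EFin \o f)).

Let norm_center_le c l : 0 < l -> open_cube c l `<=` X ->
  `|center c l| <= cube_avg f c l.
Proof.
move=> l0 cX; have mc := measurable_open_cube_rV c l.
have fc := cube_integrable l0 cX.
rewrite /center mean_open_cube// fineM//; last exact: integrable_fin_num.
rewrite normrM gtr0_norm ?invr_gt0 ?exprn_gt0//.
rewrite ler_pM2l ?invr_gt0 ?exprn_gt0//.
exact: (le_normr_Rintegral mc fc).
Qed.

Let cube_oscE c l : 0 < l -> open_cube c l `<=` X ->
  \int[mu]_(x in open_cube c l) `|f x - center c l| =
  l ^+ n * cube_osc f c l.
Proof.
move=> l0 cX; have mc := measurable_open_cube_rV c l.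
have fc := cube_integrable l0 cX.
have ln0 : l ^+ n != 0 by rewrite gt_eqF// exprn_gt0.
rewrite /cube_osc /oscillation [mean _ (fun x => _)]mean_open_cube//.
rewrite -/(center c l) fineM//; last first.
  apply: integrable_fin_num => //.
  exact: (integrable_recentered _ mc (cube_measure_lty c l0) fc).
by rewrite mulrA divff// mul1r.
Qed.

Let cube_avgE c l : 0 < l -> \int[mu]_(x in open_cube c l) `|f x| =
  l ^+ n * cube_avg f c l.
Proof.
by move=> l0; rewrite /cube_avg mulrA divff ?mul1r// gt_eqF// exprn_gt0.
Qed.

Let sub_recentered c l c' l' : 0 < l -> 0 < l' ->
  open_cube c l `<=` open_cube c' l' -> open_cube c' l' `<=` X ->
  \int[mu]_(x in open_cube c l) `|f x - center c' l'| <=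
  l' ^+ n * cube_osc f c' l'.
Proof.
move=> l0 l'0 cc' c'X; rewrite -cube_oscE//.
have mc' := measurable_open_cube_rV c' l'.
apply: (Rintegral_subset mc' (measurable_open_cube_rV c l) cc') => //.
exact: (integrable_recentered _ mc' (cube_measure_lty c' l'0)
  (cube_integrable l'0 c'X)).
Qed.

(** With [m] the mean of [f] on the larger cube, |f| <= |m| + |f - m|.  Here |m|
    is at most the average of |f| on the larger cube, and averaging |f - m|
    over the smaller cube costs the ratio of the volumes. *)
Lemma cube_avg_le_outer c l c' l' : 0 < l -> 0 < l' ->
  open_cube c l `<=` open_cube c' l' -> open_cube c' l' `<=` X ->
  cube_avg f c l <= cube_avg f c' l' + (l' / l) ^+ n * cube_osc f c' l'.
Proof.
move=> l0 l'0 cc' c'X; have cX := subset_trans cc' c'X.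
have ln0 : 0 < l ^+ n by exact: exprn_gt0.
rewrite -(ler_pM2l ln0) -cube_avgE// mulrDr.
rewrite [X in _ <= _ + X]mulrA -exprMn [l ^+ n * _]mulrC.
rewrite [l * _]mulrC divfK ?gt_eqF//.
apply: le_trans (le_Rintegral_normr_recentered (center c' l')
  (measurable_open_cube_rV c l) (cube_measure_lty c l0)
  (cube_integrable l0 cX)) _.
rewrite fine_cube_measure//; apply: lerD; last exact: sub_recentered.
by rewrite ler_pM2r// norm_center_le.
Qed.

(** The same [m] is compared with the average of |f| on the smaller cube through
    |m| <= |f| + |f - m|. *)
Lemma cube_avg_le_inner c l c' l' : 0 < l -> 0 < l' ->
  open_cube c l `<=` open_cube c' l' -> open_cube c' l' `<=` X ->
  cube_avg f c' l' <=
    cube_avg f c l + (1 + (l' / l) ^+ n) * cube_osc f c' l'.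
Proof.
move=> l0 l'0 cc' c'X; have cX := subset_trans cc' c'X.
have ln0 : 0 < l ^+ n by exact: exprn_gt0.
have ln0' : 0 < l' ^+ n by exact: exprn_gt0.
have le1 : cube_avg f c' l' <= `|center c' l'| + cube_osc f c' l'.
  rewrite -(ler_pM2l ln0') mulrDr -cube_oscE// -cube_avgE//.
  rewrite -(fine_cube_measure c') // [_ * `|_|]mulrC.
  exact: (le_Rintegral_normr_recentered _ (measurable_open_cube_rV c' l')
    (cube_measure_lty c' l'0) (cube_integrable l'0 c'X)).
apply: le_trans le1 _; rewrite mulrDl mul1r addrCA addrC lerD2r.
rewrite -(ler_pM2l ln0) mulrDr -cube_avgE//.
rewrite [X in _ <= _ + X]mulrA -exprMn [l * _]mulrC divfK ?gt_eqF// mulrC.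
rewrite -[X in _ * X <= _](fine_cube_measure c)//.
apply: le_trans (recentered_le_Rintegral_normr (center c' l')
  (measurable_open_cube_rV c l) (cube_measure_lty c l0)
  (cube_integrable l0 cX)) _.
by rewrite lerD2l; exact: sub_recentered.
Qed.

(** With this exponent, l^theta is the power |Q|^(1/p) of the volume. *)
Let theta : R := n%:R / p.

Lemma JN_scaled_sum N (c : nat -> 'rV[R]_n) (l : nat -> R) :
    (forall i, (i < N)%N -> 0 < l i /\ open_cube (c i) (l i) `<=` X) ->
    trivIset `I_N (fun i => open_cube (c i) (l i)) ->
  \sum_(i < N) (l i `^ theta * cube_osc f (c i) (l i)) `^ p <= K `^ p.
Proof.
move=> hl triv; have [_ _ /(_ N c l hl triv)] := hf.
rewrite (eq_bigr (fun i : 'I_N =>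
    ((l i `^ theta * cube_osc f (c i) (l i)) `^ p)%:E)) => [|i _].
  by rewrite sumEFin lee_fin.
have [li0 ciX] := hl i (ltn_ord i).
rewrite oscillation_fin// poweR_EFin -EFinM; congr EFin.
rewrite powRM ?powR_ge0 ?cube_osc_ge0// -powRrM.
by rewrite /theta divfK ?gt_eqF// powR_mulrn// ltW.
Qed.

Lemma cube_osc_scaled_le c l : 0 < l -> open_cube c l `<=` X ->
  l `^ theta * cube_osc f c l <= K.
Proof.
move=> l0 cX; have [K0 _ _] := hf.
have triv1 : trivIset `I_1 (fun=> open_cube c l) by move=> [|i] [|j].
have := JN_scaled_sum (fun _ _ => conj l0 cX) triv1; rewrite big_ord1.
move=> le; rewrite leNgt; apply/negP => lt; move: le.
apply/negP; rewrite -ltNge gt0_ltr_powR// nnegrE//.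
by rewrite mulr_ge0 ?powR_ge0 ?cube_osc_ge0.
Qed.

Lemma no_disjoint_oscillating_cubes (delta : R)
    (c : nat -> 'rV[R]_n) (l : nat -> R) : 0 < delta ->
  (forall i, [/\ 0 < l i, open_cube (c i) (l i) `<=` X &
     delta <= l i `^ theta * cube_osc f (c i) (l i)]) ->
  ~ trivIset setT (fun i => open_cube (c i) (l i)).
Proof.
move=> d0 hl triv.
have dp0 : 0 < delta `^ p by exact: powR_gt0.
pose N := (Num.truncn (K `^ p / delta `^ p)).+1.
have : \sum_(i < N) (l i `^ theta * cube_osc f (c i) (l i)) `^ p <= K `^ p.
  apply: JN_scaled_sum => [i _|]; first by have [] := hl i.
  exact: sub_trivIset triv.
apply/negP; rewrite -ltNge.
have : K `^ p < N%:R * delta `^ p.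
  by rewrite -ltr_pdivrMr// truncnS_gt.
move=> /lt_le_trans; apply.
rewrite mulr_natl -[X in _ *+ X]card_ord -sumr_const.
apply: ler_sum => i _; have [li0 _ dl] := hl i.
by apply: powR_le_base => //; exact: ltW.
Qed.

End JN_cubes.

(** * Averages across scales and cubes with definite oscillation *)

Section scales.
Context {R : realType} {n : nat}.
Local Notation mu := (lebesgue_measure_rV R n).
Implicit Types (c x : 'rV[R]_n) (l : R).

Context (X : set 'rV[R]_n) (K p : R) (f : 'rV[R]_n -> R).
Context (n0 : (0 < n)%N).
Context (mX : measurable (X : set (lebesgue_rV R n))).
Context (p1 : 1 < p).
Context (hf : cube_JN K p X f).

Let p0 : 0 < p. Proof. exact: lt_trans ltr01 p1. Qed.
Let theta : R := n%:R / p.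
Let theta_gt0 : 0 < theta. Proof. by rewrite divr_gt0// ltr0n. Qed.
Let theta_ltn : theta < n%:R.
Proof. by rewrite ltr_pdivrMr// ltr_pMr// ltr0n. Qed.
Let K0 : 0 <= K. Proof. by case: hf. Qed.

(** The case of comparable sides, where the ratio of the volumes is at most
    2^n. *)
Let cube_avg_close c l c' l' : 0 < l -> l' <= 2 * l ->
  open_cube c l `<=` open_cube c' l' -> open_cube c' l' `<=` X ->
  `|cube_avg f c l - cube_avg f c' l'| <= (1 + 2 ^+ n) * K * (l `^ theta)^-1.
Proof.
move=> l0 l'2 cc' c'X; have ll' := open_cube_subset_le n0 l0 cc'.
have l'0 : 0 < l' by exact: lt_le_trans ll'.
have le1 := cube_avg_le_outer mX p1 hf l0 l'0 cc' c'X.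
have le2 := cube_avg_le_inner mX p1 hf l0 l'0 cc' c'X.
have ratio : (l' / l) ^+ n <= 2 ^+ n.
  apply: lerXn2r; rewrite ?nnegrE//; first by rewrite divr_ge0// ltW.
  by rewrite ler_pdivrMr.
have lt0 : 0 < l `^ theta by exact: powR_gt0.
have oK : cube_osc f c' l' <= K * (l `^ theta)^-1.
  rewrite ler_pdivlMr// mulrC.
  apply: le_trans (cube_osc_scaled_le p1 hf l'0 c'X).
  by rewrite ler_wpM2r ?cube_osc_ge0// powR_le_base// ltW.
have o0 := cube_osc_ge0 f c' l'0.
have r0 : 0 <= (l' / l) ^+ n by rewrite exprn_ge0// divr_ge0// ltW.
have : (1 + (l' / l) ^+ n) * cube_osc f c' l' <=
    (1 + 2 ^+ n) * (K * (l `^ theta)^-1).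
  by apply: ler_pM => //; rewrite ?addr_ge0 ?lerD2l.
rewrite -mulrA ler_norml => le3; lra.
Qed.

(** The sum of the geometric series of the errors along a chain of
    doublings. *)
Let C : R := (1 + 2 ^+ n) * K / (1 - (2 `^ theta)^-1).

Let two_theta_gt1 : 1 < 2 `^ theta.
Proof.
rewrite -[ltLHS](congr1 (fun g => g theta) (powR1 R)) /=.
by apply: gt0_ltr_powR; rewrite ?nnegrE ?ltr1n.
Qed.

Let C_ge0 : 0 <= C.
Proof.
apply: divr_ge0; first by rewrite mulr_ge0// addr_ge0 ?exprn_ge0.
by rewrite subr_ge0 invf_le1 ?ltW// (lt_trans ltr01).
Qed.

(** The smaller cube is doubled, inside the larger one, until the sides are
    comparable.  The error made at the j-th doubling is of the order of
    (2^j l)^-theta, so that the total does not depend on the larger cube. *)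
Lemma cube_avg_comparable c l c' l' : 0 < l ->
  open_cube c l `<=` open_cube c' l' -> open_cube c' l' `<=` X ->
  `|cube_avg f c l - cube_avg f c' l'| <= C * (l `^ theta)^-1.
Proof.
have q1 : (2 `^ theta)^-1 < 1 by rewrite invf_lt1 ?(lt_trans ltr01).
have q0 : 0 < (2 `^ theta)^-1 by rewrite invr_gt0 (lt_trans ltr01).
have CE : C * (1 - (2 `^ theta)^-1) = (1 + 2 ^+ n) * K.
  by rewrite /C divfK// gt_eqF// subr_gt0.
have CK : (1 + 2 ^+ n) * K <= C by rewrite -CE ler_piMr// lerBlDr lerDl ltW.
move=> l0; have [m] : exists m : nat, l' <= 2 ^+ m * l.
  exists (Num.truncn (l' / l)).+1; rewrite -ler_pdivrMr//.
  apply: (le_trans (ltW (truncnS_gt _))).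
  by rewrite -natrX ler_nat ltnW// ltn_expl.
elim: m c l l0 => [|m IH] c l l0 l'm cc' c'X.
  (* here [l' <= l], which is a fortiori the comparable case *)
  apply: le_trans (cube_avg_close l0 _ cc' c'X) _; first lra.
  by rewrite ler_wpM2r// invr_ge0 powR_ge0.
have lt0 : 0 < (l `^ theta)^-1 by rewrite invr_gt0 powR_gt0.
have [l'2|l'2] := leP l' (2 * l).
  apply: le_trans (cube_avg_close l0 _ cc' c'X) _ => //.
  by rewrite ler_wpM2r// ltW.
have l2 : l <= 2 * l <= l' by lra.
have [c1 [cc1 c1c']] := cube_between l0 l2 cc'.
have l20 : 0 < 2 * l by lra.
have l'm' : l' <= 2 ^+ m * (2 * l) by rewrite mulrA -exprSr.
have := IH _ _ l20 l'm' c1c' c'X.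
have := cube_avg_close l0 (lexx _) cc1 (subset_trans c1c' c'X).
have tE : (2 * l) `^ theta = 2 `^ theta * l `^ theta.
  by rewrite powRM// ltW.
rewrite tE invfM -CE => h1 h2.
rewrite -(subrKA (cube_avg f c1 (2 * l))) (le_trans (ler_normD _ _))//.
apply: le_trans (lerD h1 h2) _.
(* with q = 2^-theta, the new error and the inductive bound add up exactly:
   C (1 - q) + C q = C *)
rewrite le_eqVlt; apply/orP; left; apply/eqP; ring.
Qed.

(** Every cube is compared with the fixed one through a common larger cube. *)
Lemma cube_avg_bounded c0 l0 : 0 < l0 -> open_cube c0 l0 `<=` X ->
  (forall c l, 0 < l -> open_cube c l `<=` X -> exists c1 l1,
    [/\ open_cube c l `<=` open_cube c1 l1,
        open_cube c0 l0 `<=` open_cube c1 l1 & open_cube c1 l1 `<=` X]) ->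
  exists2 B, 0 < B & forall c l, 0 < l -> l <= 1 -> open_cube c l `<=` X ->
    l `^ theta * cube_avg f c l <= B.
Proof.
move=> l00 c0X common.
have avg0 : 0 <= cube_avg f c0 l0 by exact: cube_avg_ge0.
have l0t : 0 <= (l0 `^ theta)^-1 by rewrite invr_ge0 powR_ge0.
set D := cube_avg f c0 l0 + C * (l0 `^ theta)^-1.
have D0 : 0 <= D by rewrite addr_ge0// mulr_ge0.
exists (D + C + 1); first by move: C_ge0 D0; lra.
move=> c l lgt0 l1 cX; have [c1 [l1' [s1 s2 s3]]] := common c l lgt0 cX.
have := cube_avg_comparable lgt0 s1 s3.
have := cube_avg_comparable l00 s2 s3.
rewrite !ler_norml => /andP[h1 _] /andP[_ h2].
have lt0 : 0 < l `^ theta by rewrite powR_gt0.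
have lt1 : l `^ theta <= 1.
  rewrite -[leRHS](congr1 (fun g => g theta) (powR1 R)) /=.
  by apply: powR_le_base => //; exact: ltW.
have h : cube_avg f c l <= D + C * (l `^ theta)^-1 by rewrite /D; lra.
have : l `^ theta * cube_avg f c l <= l `^ theta * (D + C * (l `^ theta)^-1).
  by rewrite ler_pM2l.
move/le_trans; apply; rewrite mulrDr mulrCA divff ?gt_eqF// mulr1.
nra.
Qed.

(** Sides are expressed as multiples of [l] so that the estimate is
    scale-invariant. *)
Lemma cube_avg_cover (I : finType) (P : pred I) (c : 'rV[R]_n) l
    (c0 : 'rV[R]_n) (eta : R) (v : I -> 'rV[R]_n) (kappa : R) :
  0 < l -> 0 < eta -> 0 < kappa -> open_cube c l `<=` X ->
  open_cube c0 (eta * l) `<=` open_cube c l ->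
  (forall i, open_cube (v i) (kappa * l) `<=` open_cube c l) ->
  open_cube c l `<=` open_cube c0 (eta * l) `|`
    \bigcup_(i in [set i | P i]) open_cube (v i) (kappa * l) ->
  cube_avg f c l <= eta ^+ n * cube_avg f c0 (eta * l) +
    \sum_(i | P i) kappa ^+ n * cube_avg f (v i) (kappa * l).
Proof.
move=> l0 eta0 k0 cX sub0 subv cov.
have ln0 : 0 < l ^+ n by rewrite exprn_gt0.
have E (a : R) c' : 0 < a -> a ^+ n * cube_avg f c' (a * l) =
    (l ^+ n)^-1 * \int[mu]_(x in open_cube c' (a * l)) `|f x|.
  move=> a0; rewrite /cube_avg exprMn invfM !mulrA divff ?mul1r//.
  by rewrite gt_eqF// exprn_gt0.
rewrite (E eta c0)//.
under eq_bigr => i _ do rewrite (E _ _ k0).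
rewrite -mulr_sumr -mulrDr ler_pM2l ?invr_gt0//.
apply: (Rintegral_cover (measurable_open_cube_rV c l)
  (measurable_open_cube_rV _ _) (fun i => measurable_open_cube_rV _ _)
  sub0 subv cov) => //.
exact: (integrable_norm (cube_integrable mX p1 hf l0 cX)).
Qed.

Section bounded_averages.
Context (B : R).
Context (B0 : 0 < B).
Context (hB : forall c l, 0 < l -> l <= 1 -> open_cube c l `<=` X ->
  l `^ theta * cube_avg f c l <= B).

(** On the cube enlarged by [lam] the bound [B] reads
    l^theta A(Q') <= lam^-theta B <= e / 2, so at least half of [e] must come
    from the oscillation term of [cube_avg_le_outer]. *)
Lemma oscillation_of_outgrown_average (e : R) : 0 < e ->
  exists lam delta, [/\ 1 <= lam, 0 < delta & forall c l c1, 0 < l ->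
    lam * l <= 1 -> open_cube c l `<=` open_cube c1 (lam * l) ->
    open_cube c1 (lam * l) `<=` X -> e <= l `^ theta * cube_avg f c l ->
    delta <= (lam * l) `^ theta * cube_osc f c1 (lam * l)].
Proof.
move=> e0; have [lam lam1 hlam] := exists_large_powR (2 * B / e) theta_gt0.
have lam0 : 0 < lam by lra.
have lamn : 0 < lam ^+ n by rewrite exprn_gt0.
exists lam, (e / 2 / lam ^+ n); split => //; first by rewrite !divr_gt0.
move=> c l c1 l0 l1 s1 s2 el.
have ll0 : 0 < lam * l by rewrite mulr_gt0.
have lt0 : 0 < l `^ theta by rewrite powR_gt0.
have lamt : 0 < lam `^ theta by rewrite powR_gt0.
have := cube_avg_le_outer mX p1 hf l0 ll0 s1 s2.
rewrite mulfK ?gt_eqF// => le1.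
have le2 := hB ll0 l1 s2.
have o0 := cube_osc_ge0 f c1 ll0.
have tE : (lam * l) `^ theta = lam `^ theta * l `^ theta.
  by rewrite powRM// ltW.
rewrite tE in le2 *.
set A1 := cube_avg f c1 _ in le1 le2; set o := cube_osc _ _ _ in le1 o0 *.
have le3 : l `^ theta * A1 <= e / 2.
  rewrite -(ler_pM2l lamt) mulrA (le_trans le2)//.
  by move: hlam; rewrite ler_pdivrMr//; lra.
have le4 : e / 2 <= l `^ theta * o * lam ^+ n.
  have : l `^ theta * cube_avg f c l <= l `^ theta * (A1 + lam ^+ n * o).
    by rewrite ler_pM2l.
  lra.
rewrite ler_pdivrMr// (le_trans le4)// ler_pM2r// -mulrA ler_peMl//.
  by rewrite mulr_ge0// ltW.
rewrite -[leLHS](congr1 (fun g => g theta) (powR1 R)) /=.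
by apply: powR_le_base => //; exact: ltW.
Qed.

(** Cover the cube by a fixed number of cubes of side [kappa * l].  Those whose
    closure contains [x] lie near [x]; together they are replaced by one cube of
    side [eta * l], whose scaled contribution is at most eta^(n - theta) B.
    This is at most e / 2 for a suitable [eta], and then one of the other cubes
    carries a fixed share of the rest. *)
Lemma subcube_avoiding_point (e : R) : 0 < e ->
  exists kappa e', [/\ 0 < kappa, kappa <= 1, 0 < e' & forall c l x,
    0 < l -> l <= 1 -> open_cube c l `<=` X ->
    e <= l `^ theta * cube_avg f c l ->
    exists c1, [/\ open_cube c1 (kappa * l) `<=` open_cube c l,
      e' <= (kappa * l) `^ theta * cube_avg f c1 (kappa * l) &
      exists i, x ord0 i < c1 ord0 i \/ c1 ord0 i + kappa * l < x ord0 i]].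
Proof.
move=> e0.
have nt0 : 0 < n%:R - theta by rewrite subr_gt0.
have a0 : 0 < e / 2 / B by rewrite !divr_gt0.
have [eta [eta0 eta1 heta]] := exists_small_powR a0 nt0.
have split_pow (r : R) : 0 < r -> r ^+ n = r `^ (n%:R - theta) * r `^ theta.
  move=> r0; rewrite -powRD ?subrK ?powR_mulrn// ?ltW//.
  by apply/implyP => _; rewrite gt_eqF.
(* the grid is fine enough for a cube whose closure contains [x] to lie within
   distance [eta * l / 2] of [x] *)
pose M := Num.truncn (4 / eta).
pose kappa : R := 2 / M.+2%:R.
have k0 : 0 < kappa by rewrite divr_gt0.
have k1 : kappa <= 1 by rewrite ler_pdivrMr// mul1r ler_nat.
have keta : kappa < eta / 2.
  rewrite ltr_pdivrMr// mulrC -ltr_pdivrMr ?divr_gt0//.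
  have -> : 2 / (eta / 2) = 4 / eta by field; rewrite gt_eqF.
  by apply: (lt_le_trans (truncnS_gt _)); rewrite ler_nat.
pose N := #|{ffun 'I_n -> 'I_M.+1}|.
pose e' := e / 4 / N.+1%:R.
exists kappa, e'; split => //; first by rewrite !divr_gt0.
move=> c l x l0 l1 cX el.
have kl0 : 0 < kappa * l by rewrite mulr_gt0.
have el0 : 0 < eta * l by rewrite mulr_gt0.
have klE : kappa * l = 2 * (l / M.+2%:R) by rewrite /kappa; ring.
have [c0 [sub0 hc0]] := clipped_neighbourhood_subcube c x el0
  (ler_piMl (ltW l0) eta1).
pose v (w : {ffun 'I_n -> 'I_M.+1}) : 'rV[R]_n :=
  grid_corner c (l / M.+2%:R) w.
pose P (w : {ffun 'I_n -> 'I_M.+1}) := [exists i,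
  (x ord0 i < v w ord0 i) || (v w ord0 i + kappa * l < x ord0 i)].
have subv w : open_cube (v w) (kappa * l) `<=` open_cube c l.
  by rewrite klE; exact: grid_subset.
have cov : open_cube c l `<=` open_cube c0 (eta * l) `|`
    \bigcup_(w in [set w | P w]) open_cube (v w) (kappa * l).
  move=> y yc; have [w] := grid_cover M yc; rewrite -klE => yw.
  have [Pw|] := boolP (P w); first by right; exists w.
  rewrite negb_exists => /forallP near; left; apply: hc0 => // i.
  have := near i; rewrite negb_or -!leNgt => /andP[n1 n2].
  have := yw i; rewrite ltr_norml -/(v w) => y1.
  have : kappa * l < eta / 2 * l by rewrite ltr_pM2r.
  lra.
apply: contrapT => none.
have small w : P w ->
    (kappa * l) `^ theta * cube_avg f (v w) (kappa * l) <= e'.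
  move=> /existsP[i hi]; rewrite leNgt; apply/negP => lt; apply: none.
  by exists (v w); split => //; [exact: ltW|exists i; exact/orP].
have := cube_avg_cover l0 eta0 k0 cX sub0 subv cov.
have lt0 : 0 < l `^ theta by rewrite powR_gt0.
rewrite -(ler_pM2l lt0) => /(le_trans el).
rewrite mulrDr mulr_sumr.
have scaled (r : R) c' : 0 < r ->
    l `^ theta * (r ^+ n * cube_avg f c' (r * l)) =
    r `^ (n%:R - theta) * ((r * l) `^ theta * cube_avg f c' (r * l)).
  move=> r0; have -> : (r * l) `^ theta = r `^ theta * l `^ theta.
    by rewrite powRM// ltW.
  by rewrite split_pow//; ring.
rewrite (scaled eta c0)//.
under eq_bigr => w _ do rewrite (scaled _ _ k0).
have el1 : eta * l <= 1 by rewrite mulr_ile1// ltW.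
have h1 : eta `^ (n%:R - theta) *
    ((eta * l) `^ theta * cube_avg f c0 (eta * l)) <= e / 2.
  apply: (@le_trans _ _ (e / 2 / B * B)); last by rewrite divfK// gt_eqF.
  apply: ler_pM => //; first exact: powR_ge0.
    by apply: mulr_ge0; [exact: powR_ge0|exact: cube_avg_ge0].
  exact: (hB el0 el1 (subset_trans sub0 cX)).
have kn1 : kappa `^ (n%:R - theta) <= 1.
  rewrite -[leRHS](congr1 (fun g => g (n%:R - theta)) (powR1 R)) /=.
  by apply: powR_le_base => //; exact: ltW.
have h2 : \sum_(w | P w) kappa `^ (n%:R - theta) *
    ((kappa * l) `^ theta * cube_avg f (v w) (kappa * l)) <= e / 4.
  have e'0 : 0 <= e' by rewrite !divr_ge0 ?ltW.
  apply: (@le_trans _ _ (\sum_(w : {ffun 'I_n -> 'I_M.+1}) e')).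
    rewrite big_mkcond; apply: ler_sum => w _; case: ifPn => [Pw|//].
    rewrite -[leRHS]mul1r; apply: ler_pM => //.
    - exact: powR_ge0.
    - by apply: mulr_ge0; [exact: powR_ge0|exact: cube_avg_ge0].
    - exact: small.
  rewrite sumr_const -/N -[_ *+ N]mulr_natr /e' mulrAC ler_pdivrMr//.
  by rewrite ler_wpM2l ?ler_nat// divr_ge0// ltW.
move/le_trans => /(_ _ (lerD h1 h2)); lra.
Qed.

(** A subcube away from [x] is found first, and then enlarged away from [x]; the
    constant [delta] does not depend on how close to [x] this takes place. *)
Lemma oscillating_cube_near_point (e : R) c0 L x : 0 < e -> 0 < L ->
  open_cube c0 L `<=` X ->
  exists2 delta, 0 < delta & forall r, 0 < r ->
  exists2 r', 0 < r' & forall c l, 0 < l -> l <= r' ->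
    (forall i, `|c ord0 i - x ord0 i| <= r') ->
    open_cube c l `<=` open_cube c0 L -> e <= l `^ theta * cube_avg f c l ->
  exists c1 l1, [/\ 0 < l1, open_cube c1 l1 `<=` X,
    delta <= l1 `^ theta * cube_osc f c1 l1,
    (forall y, open_cube c1 l1 y -> forall i, `|y ord0 i - x ord0 i| < r) &
    exists i, x ord0 i < c1 ord0 i \/ c1 ord0 i + l1 < x ord0 i].
Proof.
move=> e0 L0 c0X.
have [kappa [e' [k0 k1 e'0 avoid]]] := subcube_avoiding_point e0.
have [lam [delta [lam1 d0 grow]]] := oscillation_of_outgrown_average e'0.
have [rho rho0 between] := cube_between_avoiding c0 L x.
exists delta => // r r0.
(* [lam * r'] bounds the side of the enlarged cube and [2 * r'] the distance
   from its original corner to [x]; the cubes stay within [m] of [x] *)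
pose m := Num.min (Num.min r rho) (Num.min L 1).
have m0 : 0 < m by rewrite !lt_min r0 rho0 L0 ltr01.
have [mr mrho mL m1] : [/\ m <= r, m <= rho, m <= L & m <= 1].
  by rewrite /m !ge_min !lexx !orbT.
have lam3 : 0 < lam + 3 by lra.
exists (m / (lam + 3)); first by rewrite divr_gt0.
set r' := m / _; have r'E : lam * r' + 3 * r' = m.
  by rewrite -mulrDl mulrC divfK// gt_eqF.
have r'0 : 0 < r' by rewrite divr_gt0.
have lr' : 0 < lam * r' by rewrite mulr_gt0//; lra.
move=> c l l0 lr cx cc0 el.
have cX := subset_trans cc0 c0X.
have [|c1 [c1c c1e [i away]]] := avoid c l x l0 _ cX el; first lra.
have kl0 : 0 < kappa * l by rewrite mulr_gt0.
have kll : kappa * l <= l by rewrite ler_piMl// ltW.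
have skl : kappa * l <= lam * (kappa * l) by rewrite ler_peMl// ltW.
have slam : lam * (kappa * l) <= lam * r' by rewrite ler_pM2l; lra.
have c1x j : `|c1 ord0 j - x ord0 j| <= 2 * r'.
  have := (open_cube_subsetP _ _ _ kl0).1 c1c j; have := cx j.
  by rewrite !ler_norml; lra.
have [||j|c2 [c12 c20 away2]] := between c1 _ _ kl0 skl _ _
  (subset_trans c1c cc0).
- lra.
- lra.
- by apply: le_trans (c1x j) _; lra.
exists c2, (lam * (kappa * l)); split.
- by rewrite mulr_gt0//; lra.
- exact: subset_trans c20 c0X.
- by apply: grow c1e => //; [lra|exact: subset_trans c20 c0X].
- move=> y yc j; have := c1x j.
  have := (open_cube_subsetP _ _ _ kl0).1 c12 j; have := yc j.
  by rewrite ler_norml ltr_norml; lra.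
- by exists i; case: away => [/(away2 i).1|/(away2 i).2]; [left|right].
Qed.

End bounded_averages.

(** The sets [U k] are thought of as the neighbourhoods of a point, or of
    infinity, that each single cube eventually leaves.  Choosing every cube in a
    [U k] that misses the previous ones gives a disjoint sequence. *)
Lemma no_escaping_oscillating_cubes (delta : R) (U : nat -> set 'rV[R]_n) :
  0 < delta -> (forall i j, (i <= j)%N -> U j `<=` U i) ->
  ~ (forall k, exists c l, [/\ 0 < l, open_cube c l `<=` X,
       delta <= l `^ theta * cube_osc f c l, open_cube c l `<=` U k &
       exists k', open_cube c l `&` U k' = set0]).
Proof.
move=> d0 decr H.
have /choice[g hg] k : exists t : 'rV[R]_n * R * nat,
    [/\ 0 < t.1.2, open_cube t.1.1 t.1.2 `<=` X,
       delta <= t.1.2 `^ theta * cube_osc f t.1.1 t.1.2,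
       open_cube t.1.1 t.1.2 `<=` U k &
       open_cube t.1.1 t.1.2 `&` U t.2 = set0].
  by have [c [l [? ? ? ? [k' ?]]]] := H k; exists (c, l, k').
pose idx := fix idx j :=
  if j is j'.+1 then maxn (idx j') (g (idx j')).2 else 0%N.
have idx_le i j : (i <= j)%N -> (idx i <= idx j)%N.
  move=> /subnK <-; elim: (j - i)%N => // m IH.
  by rewrite addSn /= leq_max IH.
apply: (no_disjoint_oscillating_cubes p1 hf d0 (c := fun j => (g (idx j)).1.1)
  (l := fun j => (g (idx j)).1.2)) => [j|]; first by have [] := hg (idx j).
apply/trivIsetP.
have lt_disj i j : (i < j)%N ->
    open_cube (g (idx i)).1.1 (g (idx i)).1.2 `&`
    open_cube (g (idx j)).1.1 (g (idx j)).1.2 = set0.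
  move=> ij; have [_ _ _ _ e] := hg (idx i); have [_ _ _ s _] := hg (idx j).
  apply/seteqP; split=> // y [yi yj]; rewrite -e; split => //.
  apply: (decr _ (idx j)); last exact: s.
  apply: (@leq_trans (idx i.+1)); last exact: idx_le.
  by rewrite /= leq_max leqnn orbT.
move=> i j _ _; rewrite neq_ltn => /orP[|] ij; first exact: lt_disj.
by rewrite setIC; exact: lt_disj.
Qed.

End scales.

(** * Uniform smallness of the scaled averages *)

Lemma measurable_space_or_cube {R : realType} {n : nat} (X : set 'rV[R]_n) :
  X = setT \/ (exists l, is_cube X l) ->
  measurable (X : set (lebesgue_rV R n)).
Proof.
case=> [->|[l [_ [c ->]]]]; first exact: measurableT.
exact: measurable_open_cube_rV.
Qed.

Section uniform.
Context {R : realType} {n : nat}.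
Implicit Types (c x : 'rV[R]_n) (l : R).
Context (X : set 'rV[R]_n) (K p : R) (f : 'rV[R]_n -> R).
Context (n0 : (0 < n)%N).
Context (hX : X = setT \/ exists l, is_cube X l).
Context (p1 : 1 < p).
Context (hf : cube_JN K p X f).

Let theta : R := n%:R / p.

Let mX : measurable (X : set (lebesgue_rV R n)).
Proof. exact: measurable_space_or_cube. Qed.

Lemma scaled_average_bounded : exists2 B, 0 < B &
  forall c l, 0 < l -> l <= 1 -> open_cube c l `<=` X ->
    l `^ theta * cube_avg f c l <= B.
Proof.
case: hX => [XT|[l0 [l00 [c0 XE]]]].
  apply: (cube_avg_bounded n0 mX p1 hf (c0 := 0) ltr01) => [|c l l0 _].
    by rewrite XT.
  have [c1 [l1 [s1 s2]]] := setT_common_cube c 0 l0 ltr01.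
  by exists c1, l1; split => //; rewrite XT.
apply: (cube_avg_bounded n0 mX p1 hf (c0 := c0) l00) => [|c l _ cX].
  by rewrite XE.
by exists c0, l0; split; rewrite -?XE.
Qed.

(** Cubes with a large average accumulating at [x] would yield oscillating cubes
    in every neighbourhood of [x], none of which has [x] in its closure. *)
Let small_near_point_in_cube (e : R) c0 L x : 0 < e -> 0 < L ->
  open_cube c0 L `<=` X ->
  exists2 r, 0 < r & forall c l, 0 < l -> l <= r ->
    (forall i, `|c ord0 i - x ord0 i| <= r) ->
    open_cube c l `<=` open_cube c0 L -> l `^ theta * cube_avg f c l <= e.
Proof.
move=> e0 L0 c0X; have [B B0 hB] := scaled_average_bounded.
have [delta d0 osc] :=
  oscillating_cube_near_point n0 mX p1 hf B0 hB x e0 L0 c0X.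
apply: contrapT => none.
pose U (k : nat) := [set y : 'rV[R]_n |
  forall i, `|y ord0 i - x ord0 i| < k.+1%:R^-1].
apply: (no_escaping_oscillating_cubes (U := U) p1 hf d0) => [i j ij y Uy k|k].
  by apply: lt_le_trans (Uy k) _; rewrite lef_pV2 ?posrE// ler_nat ltnS.
have [|r r0 near] := osc k.+1%:R^-1; first by rewrite invr_gt0.
have [c [l [l0 lr cx cc0 el]]] : exists c l, [/\ 0 < l, l <= r,
    forall i, `|c ord0 i - x ord0 i| <= r, open_cube c l `<=` open_cube c0 L &
    e <= l `^ theta * cube_avg f c l].
  apply: contrapT => none'; apply: none; exists r => // c l l0 lr cx cc0.
  rewrite leNgt; apply/negP => lt; apply: none'; exists c, l; split => //.
  exact: ltW.
have [c1 [l1 [l10 c1X c1d c1U [i away]]]] := near c l l0 lr cx cc0 el.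
exists c1, l1; split => //.
have [g g0 hg] : exists2 g, 0 < g & forall y, open_cube c1 l1 y ->
    g <= `|y ord0 i - x ord0 i|.
  case: away => away.
    exists (c1 ord0 i - x ord0 i) => [|y /(_ i) yc]; first by lra.
    by rewrite ger0_norm; lra.
  exists (x ord0 i - c1 ord0 i - l1) => [|y /(_ i) yc]; first by lra.
  by rewrite ler0_norm; lra.
exists (Num.truncn g^-1); apply/seteqP; split => // y [/hg gy /(_ i) yU].
by have := lt_trans (le_lt_trans gy yU) (truncn_inv_lt g0); rewrite ltxx.
Qed.

Let small_near_point (e : R) x : 0 < e ->
  exists2 r, 0 < r & forall c l, 0 < l -> l <= r ->
    (forall i, `|c ord0 i - x ord0 i| <= r) ->
    open_cube c l `<=` X -> l `^ theta * cube_avg f c l <= e.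
Proof.
move=> e0; case: hX => [XT|[l0 [l00 [c0 XE]]]]; last first.
  have [|r r0 near] := @small_near_point_in_cube e c0 l0 x e0 l00.
    by rewrite XE.
  by exists r => // c l lgt0 lr cx cX; apply: near => //; rewrite -XE.
pose c0 : 'rV[R]_n := \row_i (x ord0 i - 1).
have [||r r0 near] := @small_near_point_in_cube e c0 2 x e0.
- by [].
- by rewrite XT.
exists (Num.min r 4^-1); first by rewrite lt_min r0 invr_gt0 ltr0n.
move=> c l lgt0; rewrite le_min => /andP[lr l4] cx cX; apply: near => //.
  by move=> i; apply: le_trans (cx i) _; rewrite ge_min lexx.
apply/open_cube_subsetP => // i; rewrite mxE.
have : `|c ord0 i - x ord0 i| <= 4^-1.
  by apply: le_trans (cx i) _; rewrite ge_min lexx orbT.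
by rewrite ler_norml; lra.
Qed.

(** Compactness of the box of admissible corners makes the radius uniform. *)
Lemma small_near_compact (e m : R) : 0 < e ->
  exists2 r, 0 < r & forall c l, 0 < l -> l <= r ->
    (forall i, `|c ord0 i| <= m) ->
    open_cube c l `<=` X -> l `^ theta * cube_avg f c l <= e.
Proof.
move=> e0.
pose box := [set c : 'rV[R]_n | forall i, `[- m, m]%classic (c ord0 i)].
have : compact box.
  apply: (rV_compact (A := fun=> `[- m, m]%classic)) => i.
  exact: segment_compact.
move/compact_near_coveringP => /(_ R 0^'+ (fun l c => 0 < l ->
  open_cube c l `<=` X -> l `^ theta * cube_avg f c l <= e)) [].
  move=> x _; have [r r0 near] := small_near_point x e0.
  exists (ball x r, [set l | l <= r]) => /=.
    by split; [exact: nbhsx_ballx|exact: nbhs_right_le].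
  move=> [c l] /= [xc lr] l0 cX; apply: near => // i.
  by have := xc.2 ord0 i; rewrite /ball/= distrC => /ltW.
move=> r /= r0 near; exists (r / 2); first by rewrite divr_gt0.
move=> c l l0 lr cm cX; apply: near => //=.
  by rewrite sub0r normrN gtr0_norm//; lra.
by move=> i /=; rewrite in_itv/= -ler_norml.
Qed.

(** A bounded [X] has its corners in a box.  In the whole space, cubes with a
    large average and small side would have to leave every box, hence so would
    the oscillating cubes obtained by enlarging them. *)
Lemma small_scaled_average (e : R) : 0 < e ->
  exists2 r, 0 < r & forall c l, 0 < l -> l <= r ->
    open_cube c l `<=` X -> l `^ theta * cube_avg f c l <= e.
Proof.
move=> e0; case: hX => [XT|[l0 [l00 [c0 XE]]]]; last first.
  pose m := \big[Num.max/0]_i `|c0 ord0 i| + l0.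
  have [r r0 near] := small_near_compact m e0.
  exists r => // c l lgt0 lr cX; apply: near => // i.
  have : `|c0 ord0 i| <= m - l0 by rewrite addrK; exact: le_bigmax_cond.
  have := cX; rewrite XE => /(open_cube_subsetP _ _ _ lgt0)/(_ i).
  by rewrite !ler_norml; lra.
apply: contrapT => none.
have [B B0 hB] := scaled_average_bounded.
have [lam [delta [lam1 d0 grow]]] :=
  oscillation_of_outgrown_average n0 mX p1 hf hB e0.
have lam0 : 0 < lam by lra.
pose U (k : nat) := [set y : 'rV[R]_n | exists i, k%:R < `|y ord0 i|].
apply: (no_escaping_oscillating_cubes (U := U) p1 hf d0) => [i j ij y [k yk]|k].
  by exists k; apply: le_lt_trans yk; rewrite ler_nat.
have [r r0 near] := small_near_compact (k%:R + 1) e0.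
have [c [l [l0 lr llam el]]] : exists c l, [/\ 0 < l, l <= r, l <= lam^-1 &
    e < l `^ theta * cube_avg f c l].
  apply: contrapT => none'; apply: none.
  exists (Num.min r lam^-1); first by rewrite lt_min r0 invr_gt0.
  move=> c l l0; rewrite le_min => /andP[lr llam] _.
  by rewrite leNgt; apply/negP => lt; apply: none'; exists c, l.
have ll0 : 0 < lam * l by rewrite mulr_gt0.
have ll1 : lam * l <= 1 by rewrite mulrC -ler_pdivlMr// mul1r.
have lll : l <= lam * l by rewrite ler_peMl// ltW.
exists c, (lam * l); split => //; rewrite ?XT//.
- apply: (grow c l) => //; rewrite ?XT//; last exact: ltW.
  by apply/open_cube_subsetP => // i; lra.
- move=> y yc; apply: contrapT => yU; move: el; apply/negP; rewrite -leNgt.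
  apply: near => //; rewrite ?XT// => i.
  have : `|y ord0 i| <= k%:R.
    by rewrite leNgt; apply/negP => yk; apply: yU; exists i.
  by have := yc i; rewrite !ler_norml; lra.
pose m := \big[Num.max/0]_i `|c ord0 i|.
have cm i : `|c ord0 i| <= m by exact: le_bigmax_cond.
have mk := ltW (truncnS_gt (m + 1)).
exists (Num.truncn (m + 1)).+1; apply/seteqP; split => // y [yc [i]] /=.
apply/negP; rewrite -leNgt; apply: le_trans mk.
by have := yc i; have := cm i; rewrite !ler_norml; lra.
Qed.

End uniform.

Theorem theorem3p16 (R : realType) (n : nat) (hn : (0 < n)%N)
    (X : set 'rV[R]_n) (hX : X = setT \/ exists l, is_cube X l)
    (p : R) (hp : 1 < p) (f : 'rV[R]_n -> R) (hf : JN p X f) :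
  ereal_sup
    [set ((lebesgue_measure_rV R n Q) `^ p^-1 * mean Q (fun x => `|f x|%:E))%E
       | Q in [set Q | Q `<=` X /\ exists2 l, is_cube Q l & l <= a]]
    @[a --> 0^'+] --> 0%E.
Proof.
have [K hK] := JN_cube_JN hf.
set S := fun a : R => ereal_sup _.
have mX := measurable_space_or_cube hX.
have scaledE c l : 0 < l -> open_cube c l `<=` X ->
    ((lebesgue_measure_rV R n (open_cube c l)) `^ p^-1 *
      mean (open_cube c l) (fun x => `|f x|%:E))%E =
    (l `^ (n%:R / p) * cube_avg f c l)%:E.
  move=> l0 cX; rewrite lebesgue_measure_open_cube ?ltW// mean_open_cube//.
  have fi := integrable_norm (cube_integrable mX hp hK l0 cX).
  rewrite poweR_EFin powRrM powR_mulrn ?ltW// /cube_avg !EFinM /Rintegral.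
  rewrite fineK//; exact: (integrable_fin_num (measurable_open_cube_rV c l) fi).
(* nonnegativity of the supremum needs a cube of side at most [a] in [X] *)
have S_ge0 : \forall a \near 0^'+, (0 <= S a)%E.
  have [c cX] : exists c, \forall a \near 0^'+, open_cube c a `<=` X.
    case: hX => [->|[l [l0 [c ->]]]]; first by exists 0; apply: nearW.
    exists c; near=> a; apply/open_cube_subsetP => // i.
    by rewrite lexx lerD2l; split=> //; near: a; exact: nbhs_right_le.
  near=> a; have a0 : 0 < a by [].
  have aX : open_cube c a `<=` X by near: a.
  apply: (@le_trans _ _ (a `^ (n%:R / p) * cube_avg f c a)%:E).
    by rewrite lee_fin; apply: mulr_ge0; [exact: powR_ge0|exact: cube_avg_ge0].
  rewrite -scaledE//; apply: ereal_sup_ubound; exists (open_cube c a) => //.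
  by split => //; exists a => //; split => //; exists c.
have S_small e : 0 < e -> \forall a \near 0^'+, (S a <= e%:E)%E.
  move=> e0; have [r r0 small] := small_scaled_average hn hX hp hK e0.
  near=> a; apply: ge_ereal_sup => _ [Q [QX [l [l0 [c QE]] la]] <-].
  rewrite QE in QX *; rewrite scaledE// lee_fin; apply: small => //.
  by apply: le_trans la _; near: a; exact: nbhs_right_le.
have S_fin : \forall a \near 0^'+, S a \is a fin_num.
  near=> a; rewrite ge0_fin_numE; last by near: a.
  by apply: le_lt_trans (ltry 1); near: a; exact: S_small.
apply/fine_cvgP; split => //; apply/cvgr0Pnorm_le => e e0.
near=> a; rewrite ger0_norm; last by apply: fine_ge0; near: a.
rewrite -lee_fin fineK; near: a; [exact: S_small|exact: S_fin].
Unshelve. all: by end_near.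
Qed.
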